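(* Let $(M,g)$ be a Riemannian manifold with Riemann curvature tensor $R$, let $p\in M$, and let $W,X,Y,Z\in T_pM$ and $\sigma\in\mathbb{R}$. If $(W,X,Y,Z,\sigma)$ solves the singular value problem of the Riemann tensor, then each of the following 5-tuples also solves it: $$\left(\tfrac{1}{\sqrt{2}}(W-X),\ \tfrac{1}{\sqrt{2}}(W+X),\ Y,\ Z,\ \sigma\right),$$ $$\left(W,\ X,\ \tfrac{1}{\sqrt{2}}(Y-Z),\ \tfrac{1}{\sqrt{2}}(Y+Z),\ \sigma\right),$$ $$\left(\tfrac{1}{\sqrt{2}}(W+X),\ \tfrac{1}{\sqrt{2}}(W-X),\ \tfrac{1}{\sqrt{2}}(Y+Z),\ \tfrac{1}{\sqrt{2}}(Y-Z),\ \sigma\right).$$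
   Context: Let $(M,g)$ be a Riemannian manifold, $\langle\cdot,\cdot\rangle = g(\cdot,\cdot)$, and $\nabla$ its Levi-Civita connection. The curvature operator is $R(X,Y) = [\nabla_X,\nabla_Y]-\nabla_{[X,Y]}$, and the $(0,4)$ curvature tensor is $R(W,Z,X,Y) := \langle W, R(X,Y)Z\rangle$ for $W,X,Y,Z\in T_pM$, where $T_pM$ is the tangent space of $M$ at the point $p$. Definition (singular value problem, SVP): a 5-tuple $(W,X,Y,Z,\sigma)$ with $W,X,Y,Z\in T_pM$ and $\sigma\in\mathbb{R}$ solves the singular value problem of the Riemann tensor if $$R(Y,Z)X=\sigma W,\quad R(Z,Y)W=\sigma X,\quad R(W,X)Z=\sigma Y,\quad R(X,W)Y=\sigma Z,$$ and $$\langle W,W\rangle=\langle X,X\rangle=\langle Y,Y\rangle=\langle Z,Z\rangle=1.$$ In a 5-tuple the entries are always listed in the order: first vector in the role of $W$, second of $X$, third of $Y$, fourth of $Z$, and the scalar in the role of $\sigma$.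
   Formalization: When σ = 0 it is additionally assumed that ⟨W,X⟩ = 0 and ⟨Y,Z⟩ = 0; without this the claim fails (flat space, σ = 0, W = X gives (W−X)/√2 = 0, not a unit vector); for σ ≠ 0 nothing is added. *)

(* Defs.v *)
From HB Require Import structures.
From mathcomp Require Import all_boot all_order all_algebra.
From mathcomp Require Import all_classical all_reals all_analysis.

Set Implicit Arguments.
Unset Strict Implicit.
Unset Printing Implicit Defensive.

Import Order.TTheory GRing.Theory Num.Theory.
Import numFieldNormedType.Exports.

Local Open Scope classical_set_scope.
Local Open Scope ring_scope.

(* [Ck k D f]: f is of class C^k on the open set D of R^n. In finite dimension,
   asking for differentiability of f and for class C^k of each directional
   derivative 'D_v f is the usual definition of class C^(k+1). *)
Fixpoint Ck (R : realType) (n : nat) (W : normedModType R) (k : nat)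
    (D : set 'rV[R]_n) (f : 'rV[R]_n -> W) : Prop :=
  match k with
  | 0%N => forall x, D x -> {for x, continuous f}
  | k'.+1 => (forall x, D x -> differentiable f x) /\
             (forall v : 'rV[R]_n, Ck k' D ('D_v f))
  end.

Definition Cinfty (R : realType) (n : nat) (W : normedModType R)
    (D : set 'rV[R]_n) (f : 'rV[R]_n -> W) : Prop :=
  forall k : nat, Ck k D f.

(* A chart: a homeomorphism from an open set of T onto an open set of R^n. The
   two maps are total, with irrelevant values outside [dom] and [codom]. *)
Record chart (R : realType) (n : nat) (T : topologicalType) := Chart {
  dom : set T;
  fwd : T -> 'rV[R]_n;
  bwd : 'rV[R]_n -> T;
  dom_open : open dom;
  codom_open : open (fwd @` dom);
  fwdK : forall p, dom p -> bwd (fwd p) = p;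
  fwd_continuous : forall p, dom p -> {for p, continuous fwd};
  bwd_continuous : forall x, (fwd @` dom) x -> {for x, continuous bwd} }.

(* [chart_at p] is a chosen chart of the atlas around p. It carries no geometric
   information: it only serves to represent tangent vectors (see [tangent]). *)
Record manifold (R : realType) (n : nat) := Manifold {
  space :> topologicalType;
  space_hausdorff : hausdorff_space space;
  space_second_countable : @second_countable space;
  atlas : set (chart R n space);
  transition_smooth : forall a b, atlas a -> atlas b ->
    Cinfty (fwd a @` (dom a `&` dom b)) (fwd b \o bwd a);
  chart_at : space -> chart R n space;
  chart_at_atlas : forall p, atlas (chart_at p);
  chart_at_dom : forall p, dom (chart_at p) p }.

Section Calculus.
Variables (R : realType) (n : nat) (M : manifold R n).

(* T_pM is the set of pairs (a, v) with a a chart around p and v in R^n, modulo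
   (a, v) ~ (b, D(fwd b o bwd a)(fwd a p) v). Each class has exactly one
   representative (chart_at p, v), and v is what stands for the class. *)
Definition tangent (p : M) : lmodType R := 'rV[R]_n.

(* The components in the chart a around p of a tangent vector at p. *)
Definition coords (a : chart R n M) (p : M) (v : tangent p) : 'rV[R]_n :=
  'd (fwd a \o bwd (chart_at p)) (fwd (chart_at p) p) v.

Definition smooth_fun (U : set M) (f : M -> R) : Prop :=
  forall a, atlas a -> Cinfty (fwd a @` (U `&` dom a)) (f \o bwd a).

(* The derivative v f of a function f along a tangent vector v at p. *)
Definition dirder (p : M) (v : tangent p) (f : M -> R) : R :=
  'd (f \o bwd (chart_at p)) (fwd (chart_at p) p) v.

Definition vfield := forall p : M, tangent p.

Definition vfield_in (a : chart R n M) (X : vfield) (x : 'rV[R]_n) : 'rV[R]_n :=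
  coords a (X (bwd a x)).

(* X is a smooth vector field on the open set U; its values outside U are
   irrelevant. *)
Definition smooth_vfield (U : set M) (X : vfield) : Prop :=
  forall a, atlas a -> Cinfty (fwd a @` (U `&` dom a)) (vfield_in a X).

(* In coordinates, [X, Y]^i = X^j d_j Y^i - Y^j d_j X^i. *)
Definition bracket (X Y : vfield) : vfield := fun p =>
  let a := chart_at p in
  ('d (vfield_in a Y) (fwd a p) (X p) : 'rV[R]_n)
    - 'd (vfield_in a X) (fwd a p) (Y p).

(* [nabla p v Y] is the covariant derivative at p of Y along v; it is only
   meaningful when Y is smooth in a neighbourhood of p. *)
Definition covder := forall p : M, tangent p -> vfield -> tangent p.

(* A connection on TM, acting on vector fields defined on open sets of M. *)
Record is_connection (nabla : covder) : Prop := IsConnection {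
  nabla_local : forall (U : set M) (p : M) (v : tangent p) (Y Z : vfield),
    open U -> U p -> smooth_vfield U Y -> smooth_vfield U Z ->
    (forall q, U q -> Y q = Z q) -> nabla p v Y = nabla p v Z;
  nabla_linear : forall (U : set M) (p : M) (c : R) (v w : tangent p)
      (Y : vfield),
    open U -> U p -> smooth_vfield U Y ->
    nabla p (c *: v + w) Y = c *: nabla p v Y + nabla p w Y;
  nabla_add : forall (U : set M) (p : M) (v : tangent p) (Y Z : vfield),
    open U -> U p -> smooth_vfield U Y -> smooth_vfield U Z ->
    nabla p v (fun q => Y q + Z q) = nabla p v Y + nabla p v Z;
  nabla_leibniz : forall (U : set M) (p : M) (v : tangent p) (f : M -> R)
      (Y : vfield),
    open U -> U p -> smooth_fun U f -> smooth_vfield U Y ->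
    nabla p v (fun q => f q *: Y q) = dirder v f *: Y p + f p *: nabla p v Y;
  nabla_smooth : forall (U : set M) (X Y : vfield),
    open U -> smooth_vfield U X -> smooth_vfield U Y ->
    smooth_vfield U (fun q => nabla q (X q) Y) }.

(* R(X,Y)Z = nabla_X nabla_Y Z - nabla_Y nabla_X Z - nabla_[X,Y] Z *)
Definition curvature (nabla : covder) (X Y Z : vfield) : vfield := fun p =>
  nabla p (X p) (fun q => nabla q (Y q) Z)
    - nabla p (Y p) (fun q => nabla q (X q) Z)
    - nabla p (bracket X Y p) Z.

(* R(x,y)z for x, y, z in T_pM: the common value at p of R(X,Y)Z for all smooth
   local vector fields X, Y, Z extending x, y, z. *)
Definition riemann (nabla : covder) (p : M) (x y z : tangent p) : tangent p :=
  get [set w : 'rV[R]_n | forall (U : set M) (X Y Z : vfield),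
    open U -> U p ->
    smooth_vfield U X -> smooth_vfield U Y -> smooth_vfield U Z ->
    X p = x -> Y p = y -> Z p = z -> curvature nabla X Y Z p = w].

Record is_metric (g : forall p : M, tangent p -> tangent p -> R) : Prop :=
  IsMetric {
  metric_linear : forall (p : M) (c : R) (v w u : tangent p),
    g p (c *: v + w) u = c * g p v u + g p w u;
  metric_sym : forall (p : M) (v w : tangent p), g p v w = g p w v;
  metric_pos : forall (p : M) (v : tangent p), v != 0 -> 0 < g p v v;
  metric_smooth : forall (U : set M) (X Y : vfield),
    open U -> smooth_vfield U X -> smooth_vfield U Y ->
    smooth_fun U (fun q => g q (X q) (Y q)) }.

End Calculus.

Record riemannian_manifold (R : realType) (n : nat) := RiemannianManifold {
  underlying :> manifold R n;
  metric : forall p : underlying, tangent p -> tangent p -> R;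
  metricP : is_metric metric }.

Arguments metric {R n} _ {p} _ _.

Record is_levi_civita (R : realType) (n : nat) (M : riemannian_manifold R n)
    (nabla : covder M) : Prop := IsLeviCivita {
  levi_civita_connection : is_connection nabla;
  torsion_free : forall (U : set M) (p : M) (X Y : vfield M),
    open U -> U p -> smooth_vfield U X -> smooth_vfield U Y ->
    nabla p (X p) Y - nabla p (Y p) X = bracket X Y p;
  metric_compatible : forall (U : set M) (p : M) (v : tangent p)
      (Y Z : vfield M),
    open U -> U p -> smooth_vfield U Y -> smooth_vfield U Z ->
    dirder v (fun q => metric M (Y q) (Z q)) =
      metric M (nabla p v Y) (Z p) + metric M (Y p) (nabla p v Z) }.

Definition solves_svp (R : realType) (n : nat) (M : riemannian_manifold R n)
    (nabla : covder M) (p : M) (W X Y Z : tangent p) (sigma : R) : Prop :=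
  [/\ riemann nabla Y Z X = sigma *: W,
      riemann nabla Z Y W = sigma *: X,
      riemann nabla W X Z = sigma *: Y &
      riemann nabla X W Y = sigma *: Z] /\
  [/\ metric M W W = 1, metric M X X = 1, metric M Y Y = 1 &
      metric M Z Z = 1].

(* Main.v *)
Require Import Defs.
From HB Require Import structures.
From mathcomp Require Import all_boot all_order all_algebra.
From mathcomp Require Import all_classical all_reals all_analysis.
From mathcomp Require Import ring lra.

Set Implicit Arguments.
Unset Strict Implicit.
Unset Printing Implicit Defensive.

Import Order.TTheory GRing.Theory Num.Theory.
Import numFieldNormedType.Exports.

Local Open Scope classical_set_scope.
Local Open Scope ring_scope.

(** Each of the three tuples arises from the given one by turning the orthonormal
    pair (W, X), or (Y, Z), or both, by an eighth of a turn in its own plane,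
    up to the two evident symmetries of the singular value problem
    [(W, X, Y, Z) -> (X, W, Z, Y)] and [(W, X, Y, Z) -> (Y, Z, W, X)].
    So a single rotation has to be treated ([solves_svp_rotate]). The operator
    R(W, X) only sees the bivector W /\ X, which a rotation in the plane of W
    and X leaves alone ([riemann_rotate]); and on that plane R(Y, Z) acts as
    sigma times a quarter turn, which commutes with rotations. The new vectors
    are unit vectors because W and X are orthogonal: as <R(Y, Z)X, X> = 0, the
    equation R(Y, Z)X = sigma W forces sigma <W, X> = 0, so orthogonality is
    automatic for sigma <> 0 and is a hypothesis for sigma = 0.

    The argument uses that R(x, y)z is linear in x and z, antisymmetric
    in x, y, and that <R(x, y)z, z> = 0. Since [riemann] is defined as the common
    value of the curvature of all local extensions of x, y, z, these facts
    rest on the tensoriality of the curvature of vector fields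
    ([curvature_tensor], [riemannE]):
    - the curvature of fields is local and linear over smooth functions
      ([curvatureZl], [curvatureZr]), and an operator with these properties only
      depends on the value of the field at the point, because near the point
      every field is a combination of coordinate fields ([tensorial]);
    - coordinate fields also extend every tangent vector, so that the
      common value is attained;
    - linearity in the differentiated field and <R(x, y)z, z> = 0 both come down
      to [X, Y]f = X(Yf) - Y(Xf) ([dirder_bracket]), hence to the symmetry of
      second derivatives ([derive_commute]).
    Behind this stands the calculus of C^infty maps between open sets of R^n:
    closure under sums, products and composition. *)

(** * Smooth maps between open sets of R^n *)

(** The maps read in a chart are only known near a point, so differentiability
    has to depend on the germ of the map alone. *)
Lemma is_diff_near_eq (R : realType) (V W : normedModType R) (f g : V -> W)
    (x : V) :
  {near x, f =1 g} -> differentiable f x -> is_diff x g ('d f x).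
Proof.
move=> fg df.
have gloc : g \o shift x = cst (g x) + 'd f x +o_ 0 id.
  have /eqaddoP fo := diff_locally df; apply/eqaddoP => e e0.
  rewrite -(nbhs_singleton fg).
  have fg0 : \forall h \near (0 : V), f (h + x) = g (h + x).
    move: fg; rewrite (near_shift 0 x); apply: filterS => h /=.
    by rewrite subr0.
  apply: filterS2 fg0 (fo e e0) => h fgh.
  by rewrite -![(_ - _ : _ -> _) _]/(_ - _) /= fgh.
have dgE : 'd g x = 'd f x :> (V -> W).
  by apply: diff_unique gloc; exact: diff_continuous.
split=> //; apply/diff_locallyP; rewrite dgE; split=> //.
exact: diff_continuous.
Qed.

Lemma row_delta_sum (R : realType) (n : nat) (v : 'rV[R]_n) :
  v = \sum_(i < n) v 0 i *: delta_mx 0 i.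
Proof. by rewrite [LHS]row_sum_delta. Qed.

Section Smooth.
Variables (R : realType) (n : nat).
Implicit Types (W : normedModType R) (D : set 'rV[R]_n) (k : nat).

Lemma Ck_sub W k D D' (f : 'rV[R]_n -> W) : D `<=` D' -> Ck k D' f -> Ck k D f.
Proof.
move=> sDD'; elim: k f => [|k IHk] f /= => [Cf x /sDD'|[df Cf]]; first exact: Cf.
by split=> [x /sDD'|v]; [exact: df|exact/IHk/Cf].
Qed.

Lemma Cinfty_sub W D D' (f : 'rV[R]_n -> W) :
  D `<=` D' -> Cinfty D' f -> Cinfty D f.
Proof. by move=> sDD' Cf k; exact: Ck_sub (Cf k). Qed.

Lemma open_near_eq W D (f g : 'rV[R]_n -> W) x :
  open D -> D x -> {in D, f =1 g} -> {near x, f =1 g}.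
Proof.
move=> Do Dx fg; apply: filterS (open_nbhs_nbhs (conj Do Dx)) => y Dy.
by apply: fg; rewrite inE.
Qed.

Lemma eq_Ck W k D (f g : 'rV[R]_n -> W) :
  Ck k D f -> open D -> {in D, f =1 g} -> Ck k D g.
Proof.
move=> + Do; elim: k f g => [|k IHk] f g /= => [Cf fg x Dx|[df Cf] fg].
  rewrite /prop_for /continuous_at -(fg x) ?inE//.
  exact: cvg_trans (near_eq_cvg (open_near_eq Do Dx fg)) (Cf x Dx).
split=> [x Dx|v].
  by have [] := is_diff_near_eq (open_near_eq Do Dx fg) (df x Dx).
apply: IHk (Cf v) _ => x /[1!inE] Dx.
by apply: near_eq_derive; exact: open_near_eq Do Dx fg.
Qed.

Lemma eq_Cinfty W D (f g : 'rV[R]_n -> W) :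
  Cinfty D f -> open D -> {in D, f =1 g} -> Cinfty D g.
Proof. by move=> Cf Do fg k; exact: eq_Ck (Cf k) Do fg. Qed.

Lemma Cinfty_diff W D (f : 'rV[R]_n -> W) x :
  Cinfty D f -> D x -> differentiable f x.
Proof. by move=> Cf; have [df _] := Cf 1%N; exact: df. Qed.

Lemma Cinfty_derive W D (f : 'rV[R]_n -> W) v :
  Cinfty D f -> Cinfty D ('D_v f).
Proof. by move=> Cf k; have [_ Df] := Cf k.+1; exact: Df. Qed.

Lemma Ck0 W D (f : 'rV[R]_n -> W) :
  (forall x, D x -> differentiable f x) -> Ck 0 D f.
Proof. by move=> df x /df; exact: differentiable_continuous. Qed.

Lemma Ck_cst W k D (a : W) : open D -> Ck k D (cst a).
Proof.
move=> Do; elim: k a => [|k IHk] a; first by apply: Ck0.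
split=> [x _|v]; first exact: differentiable_cst.
apply: eq_Ck (IHk 0) _ _ => // x _.
by rewrite derive_cst.
Qed.

Lemma CkD W k D (f g : 'rV[R]_n -> W) :
  open D -> Ck k D f -> Ck k D g -> Ck k D (f + g).
Proof.
move=> Do; elim: k f g => [|k IHk] f g /= => [Cf Cg x Dx|[df Cf] [dg Cg]].
  by apply: continuousD; [exact: Cf|exact: Cg].
split=> [x Dx|v]; first by apply: differentiableD; [exact: df|exact: dg].
apply: eq_Ck (IHk _ _ (Cf v) (Cg v)) _ _ => // x /[1!inE] Dx.
by rewrite deriveD//; apply: diff_derivable; [exact: df|exact: dg].
Qed.

Lemma Ck_sum W k D m (f : 'I_m -> 'rV[R]_n -> W) :
  open D -> (forall i, Ck k D (f i)) -> Ck k D (\sum_(i < m) f i).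
Proof.
move=> Do Cf; apply: (big_ind (Ck k D)) => //; first exact: Ck_cst.
by move=> *; exact: CkD.
Qed.

Lemma Cinfty_cst W D (a : W) : open D -> Cinfty D (cst a).
Proof. by move=> Do k; exact: Ck_cst. Qed.

Lemma CinftyD W D (f g : 'rV[R]_n -> W) :
  open D -> Cinfty D f -> Cinfty D g -> Cinfty D (f + g).
Proof. by move=> Do Cf Cg k; exact: CkD. Qed.

Lemma Cinfty_sum W D m (f : 'I_m -> 'rV[R]_n -> W) :
  open D -> (forall i, Cinfty D (f i)) -> Cinfty D (\sum_(i < m) f i).
Proof. by move=> Do Cf k; apply: Ck_sum => // i; exact: Cf. Qed.

Lemma Ck_pred W k D (f : 'rV[R]_n -> W) : Ck k.+1 D f -> Ck k D f.
Proof.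
elim: k f => [|k IHk] f [df Cf]; first exact: Ck0.
by split=> // v; apply: IHk; exact: Cf.
Qed.

Lemma CkM k D (f g : 'rV[R]_n -> R) :
  open D -> Ck k D f -> Ck k D g -> Ck k D (f * g).
Proof.
move=> Do; elim: k f g => [|k IHk] f g => [Cf Cg x Dx|Cf Cg].
  by apply: continuousM; [exact: Cf|exact: Cg].
have [[df Df] [dg Dg]] := (Cf, Cg).
split=> [x Dx|v]; first by apply: differentiableM; [exact: df|exact: dg].
have := CkD Do (IHk _ _ (Ck_pred Cf) (Dg v)) (IHk _ _ (Ck_pred Cg) (Df v)).
move/eq_Ck; apply => // x /[1!inE] Dx.
by rewrite deriveM//; apply: diff_derivable; [exact: df|exact: dg].
Qed.

Lemma CinftyM D (f g : 'rV[R]_n -> R) :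
  open D -> Cinfty D f -> Cinfty D g -> Cinfty D (f * g).
Proof. by move=> Do Cf Cg k; exact: CkM. Qed.

Lemma differentiable_row m (f : 'rV[R]_n -> 'rV[R]_m) x :
  (forall i, differentiable (fun y => f y 0 i) x) -> differentiable f x.
Proof.
move=> df.
have -> : f = \sum_(i < m) (fun y => f y 0 i *: (delta_mx 0 i : 'rV[R]_m)).
  by apply/funext => y; rewrite fct_sumE; exact: row_delta_sum.
by apply: differentiable_sum => i; exact: differentiableZl.
Qed.

Lemma differentiable_entry m (f : 'rV[R]_n -> 'rV[R]_m) x i :
  differentiable f x -> differentiable (fun y => f y 0 i) x.
Proof.
move=> df; exact: (@differentiable_comp _ _ _ _ f (fun N : 'rV[R]_m => N 0 i)
  x df (differentiable_coord _ _ _)).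
Qed.

Lemma derive_entry m (f : 'rV[R]_n -> 'rV[R]_m) x v i :
  differentiable f x -> 'D_v (fun y => f y 0 i) x = 'D_v f x 0 i.
Proof. by move=> df; rewrite derive_mx ?mxE//; exact: diff_derivable. Qed.

Lemma Cinfty_entry m D (f : 'rV[R]_n -> 'rV[R]_m) i :
  open D -> Cinfty D f -> Cinfty D (fun x => f x 0 i).
Proof.
move=> Do Cf k; elim: k f Cf => [|k IHk] f Cf.
  by apply: Ck0 => x Dx; apply: differentiable_entry; exact: (Cinfty_diff Cf Dx).
split=> [x Dx|v];
  first by apply: differentiable_entry; exact: (Cinfty_diff Cf Dx).
apply: eq_Ck (IHk _ (Cinfty_derive v Cf)) _ _ => // x /[1!inE] Dx.
by rewrite derive_entry//; exact: Cinfty_diff Cf Dx.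
Qed.

Lemma Cinfty_row m D (f : 'rV[R]_n -> 'rV[R]_m) :
  open D -> (forall i, Cinfty D (fun x => f x 0 i)) -> Cinfty D f.
Proof.
move=> Do Cf k; elim: k f Cf => [|k IHk] f Cf.
  by apply: Ck0 => x Dx; apply: differentiable_row => i; exact: Cinfty_diff Dx.
have df x : D x -> differentiable f x.
  by move=> Dx; apply: differentiable_row => i; exact: Cinfty_diff Dx.
split=> // v; apply: IHk => i.
apply: eq_Cinfty (Cinfty_derive v (Cf i)) _ _ => // x /[1!inE] Dx.
by rewrite derive_entry//; exact: df.
Qed.

Lemma CinftyZ m D (f : 'rV[R]_n -> R) (g : 'rV[R]_n -> 'rV[R]_m) :
  open D -> Cinfty D f -> Cinfty D g -> Cinfty D (fun x => f x *: g x).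
Proof.
move=> Do Cf Cg; apply: Cinfty_row => // i.
apply: eq_Cinfty (CinftyM Do Cf (Cinfty_entry i Do Cg)) _ _ => // x _.
by rewrite mxE.
Qed.

Lemma diff_row W (f : 'rV[R]_n -> W) x v :
  differentiable f x -> 'd f x v = \sum_(j < n) v 0 j *: 'D_(delta_mx 0 j) f x.
Proof.
move=> df; rewrite {1}[v]row_delta_sum linear_sum; apply: eq_bigr => j _.
by rewrite linearZ deriveE.
Qed.

End Smooth.

Section SmoothComp.
Variables (R : realType) (m n : nat).

(** By the chain rule a directional derivative of [f \o g] is a sum of products
    of entries of derivatives of [g] with [h \o g], where [h] is a partial
    derivative of [f]. As [h] is again C^infty, the induction on the order has to
    run over all smooth [f]. *)
Lemma Cinfty_comp_scalar (D : set 'rV[R]_m) (E : set 'rV[R]_n)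
    (g : 'rV[R]_m -> 'rV[R]_n) (f : 'rV[R]_n -> R) :
  open D -> (forall x, D x -> E (g x)) -> Cinfty D g -> Cinfty E f ->
  Cinfty D (f \o g).
Proof.
move=> Do gDE Cg Cf k; elim: k f Cf => [|k IHk] f Cf.
  apply: Ck0 => x Dx; apply: differentiable_comp; first exact: Cinfty_diff Cg Dx.
  by apply: Cinfty_diff Cf _; exact: gDE.
have dg x : D x -> differentiable g x by move=> Dx; exact: Cinfty_diff Cg Dx.
have df x : D x -> differentiable f (g x).
  by move=> Dx; apply: Cinfty_diff Cf _; exact: gDE.
split=> [x Dx|v].
  by apply: differentiable_comp; [exact: dg|exact: df].
pose h j := 'D_(delta_mx 0 j) f.
suff Ch : Ck k D (\sum_(j < n) ((fun x => 'D_v g x 0 j) * (h j \o g))).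
  apply: eq_Ck Ch _ _ => // x /[1!inE] Dx.
  rewrite fct_sumE deriveE; last by apply: differentiable_comp; auto.
  rewrite diff_comp; [|by auto..].
  rewrite /= (diff_row _ (df _ Dx)); apply: eq_bigr => j _.
  by rewrite /h /= -(deriveE v (dg _ Dx)).
apply: Ck_sum => // j; apply: CkM => //.
  exact: (Cinfty_entry j Do (Cinfty_derive v Cg) k).
by apply: IHk; exact: Cinfty_derive.
Qed.

Lemma Cinfty_comp p (D : set 'rV[R]_m) (E : set 'rV[R]_n)
    (g : 'rV[R]_m -> 'rV[R]_n) (f : 'rV[R]_n -> 'rV[R]_p) :
  open D -> open E -> (forall x, D x -> E (g x)) -> Cinfty D g -> Cinfty E f ->
  Cinfty D (f \o g).
Proof.
move=> Do Eo gDE Cg Cf; apply: Cinfty_row => // i.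
exact: Cinfty_comp_scalar gDE Cg (Cinfty_entry i Eo Cf).
Qed.

End SmoothComp.

(** * Symmetry of second derivatives *)

Section Schwarz.
Variables (R : realType) (V : normedModType R).
Implicit Types (f : V -> R) (x y u v : V).

Lemma is_derive_line f y u (s : R) : derivable f (y + s *: u) u ->
  is_derive s 1 (fun t : R => f (y + t *: u)) ('D_u f (y + s *: u)).
Proof.
pose q (h : R) := h^-1 *: (f (h *: u + (y + s *: u)) - f (y + s *: u)).
have qE : (fun h : R => h^-1 *: (((fun t : R => f (y + t *: u)) \o shift s)
    (h *: 1) - f (y + s *: u))) = q.
  apply/funext => h; rewrite /q /= [h *: 1]mulr1 scalerDl.
  by rewrite addrCA.
by move=> df; split; rewrite /derivable /derive qE.
Qed.

Lemma mvt_line f y u (h : R) : 0 < h ->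
  (forall s : R, 0 <= s <= h -> derivable f (y + s *: u) u) ->
  exists2 s : R, 0 < s < h & f (y + h *: u) - f y = 'D_u f (y + s *: u) * h.
Proof.
move=> h0 df; pose F := fun t : R => f (y + t *: u).
have dF s : s \in `[0, h]%R -> is_derive s 1 F ('D_u f (y + s *: u)).
  by rewrite in_itv /= => sh; apply: is_derive_line; exact: df.
have cF : {within `[0, h], continuous F}.
  by apply: derivable_within_continuous => s /dF[].
have dF' s : s \in `]0, h[%R -> is_derive s 1 F ('D_u f (y + s *: u)).
  by move=> /subset_itv_oo_cc; exact: dF.
have [s sh] := MVT h0 dF' cF.
rewrite /F scale0r addr0 subr0 => ->.
by exists s; rewrite // in_itv /= in sh.
Qed.

Lemma is_derive_translate f y c u : derivable f (y + c) u ->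
  is_derive y u (fun z => f (z + c)) ('D_u f (y + c)).
Proof.
pose q (h : R) := h^-1 *: (f (h *: u + (y + c)) - f (y + c)).
have qE : (fun h : R => h^-1 *: (((fun z => f (z + c)) \o shift y)
    (h *: u) - f (y + c))) = q.
  by apply/funext => h; rewrite /q /= addrA.
by move=> df; split; rewrite /derivable /derive qE.
Qed.

(** The mean value theorem is applied in direction [u] to
    [y |-> f (y + h *: v) - f y], and then in direction [v] to the derivative of
    [f] along [u]. The left-hand side is, up to reordering, symmetric in
    [u] and [v]. *)
Lemma second_difference (D : set V) f x u v (h : R) : 0 < h ->
  (forall s t : R, 0 <= s <= h -> 0 <= t <= h -> D (x + s *: u + t *: v)) ->
  (forall y, D y -> derivable f y u) ->
  (forall y, D y -> derivable ('D_u f) y v) ->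
  exists s t : R, [/\ 0 < s < h, 0 < t < h &
    f (x + h *: u + h *: v) - f (x + h *: u) - (f (x + h *: v) - f x) =
      'D_v ('D_u f) (x + s *: u + t *: v) * h * h].
Proof.
move=> h0 Dbox df ddf; pose G y := f (y + h *: v) - f y.
have h1 : 0 <= h <= h by rewrite lexx ltW.
have h2 : 0 <= (0 : R) <= h by rewrite lexx ltW.
have dG s : 0 <= s <= h -> is_derive (x + s *: u) u G
    ('D_u f (x + s *: u + h *: v) - 'D_u f (x + s *: u)).
  move=> sh; have D1 := Dbox s h sh h1; have := Dbox s 0 sh h2.
  rewrite scale0r addr0 => D2; apply: is_deriveB.
    by apply: is_derive_translate; exact: df.
  by apply: derivableP; exact: df.
have [|s sh GE] := @mvt_line G x u h h0; first by move=> s /dG[].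
have sh' : 0 <= s <= h by case/andP: sh => s0 s1; rewrite !ltW.
have [|t th tE] := @mvt_line ('D_u f) (x + s *: u) v h h0.
  by move=> t th; apply: ddf; exact: Dbox.
exists s, t; split=> //; rewrite -tE.
by have [_ <-] := dG _ sh'; rewrite -GE /G addrAC.
Qed.

(** On small parallelograms at [x] with sides [h *: u] and [h *: v], the second
    difference is [h ^+ 2] times a value of either mixed derivative near [x]; by
    continuity, the two mixed derivatives cannot differ at [x]. *)
Lemma derive_commute (D : set V) f x u v : open D -> D x ->
  (forall y, D y -> derivable f y u) ->
  (forall y, D y -> derivable f y v) ->
  (forall y, D y -> derivable ('D_u f) y v) ->
  (forall y, D y -> derivable ('D_v f) y u) ->
  {for x, continuous ('D_v ('D_u f))} -> {for x, continuous ('D_u ('D_v f))} ->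
  'D_v ('D_u f) x = 'D_u ('D_v f) x.
Proof.
move=> Do Dx du dv duv dvu cuv cvu; apply/eqP/negP => /negP neq.
set A : V -> R := 'D_v ('D_u f) in cuv neq *.
set B : V -> R := 'D_u ('D_v f) in cvu neq *.
pose e := `|A x - B x| / 2.
have e0 : 0 < e by rewrite divr_gt0// normr_gt0 subr_eq0.
have nA : \forall y \near x, `|A x - A y| < e.
  exact: ((cvgrPdist_lt _ _).1 cuv e e0).
have nB : \forall y \near x, `|B x - B y| < e.
  exact: ((cvgrPdist_lt _ _).1 cvu e e0).
have nDAB : nbhs x (D `&` ([set y | `|A x - A y| < e]
    `&` [set y | `|B x - B y| < e])).
  by apply: (filterI _ (filterI nA nB)); apply: open_nbhs_nbhs.
have [r /= r0 rP] := (nbhs_normP _ _).1 nDAB.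
(* The side [h] makes the parallelogram fit in the ball of radius [r]; the
   summand 1 keeps [M] positive when [u] and [v] vanish. *)
pose M := `|u| + `|v| + 1.
have M0 : 0 < M by rewrite ltr_wpDl// addr_ge0.
pose h := r / M.
have h0 : 0 < h by rewrite divr_gt0.
have box s t : 0 <= s <= h -> 0 <= t <= h ->
    [/\ D (x + s *: u + t *: v), `|A x - A (x + s *: u + t *: v)| < e &
        `|B x - B (x + s *: u + t *: v)| < e].
  move=> /andP[s0 sh] /andP[t0 th].
  suff xr : `|x - (x + s *: u + t *: v)| < r.
    by have [Dp [Ap Bp]] := rP _ xr; split; [exact: Dp|exact: Ap|exact: Bp].
  rewrite -addrA opprD addrA subrr sub0r normrN.
  apply: le_lt_trans (ler_normD _ _) _; rewrite !normrZ !ger0_norm//.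
  apply: (@le_lt_trans _ _ (h * (`|u| + `|v|))).
    by rewrite mulrDr lerD// ler_wpM2r.
  rewrite -[ltRHS](@divfK _ M) ?gt_eqF// -/h ltr_pM2l//.
  by rewrite /M ltrDl.
have [|||s [t [sh th E1]]] := @second_difference D f x u v h h0.
- by move=> s t sh th; case: (box s t sh th).
- exact: du.
- exact: duv.
have [|||s' [t' [sh' th' E2]]] := @second_difference D f x v u h h0.
- by move=> s' t' sh' th'; rewrite addrAC; case: (box t' s' th' sh').
- exact: dv.
- exact: dvu.
have AB : A (x + s *: u + t *: v) = B (x + t' *: u + s' *: v).
  have hK (a b : R) : a * h * h = b * h * h -> a = b.
    by move=> /(mulIf (lt0r_neq0 h0))/(mulIf (lt0r_neq0 h0)).
  rewrite [x + h *: v + _]addrAC [X in 'D_u _ X]addrAC in E2.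
  refine (hK _ _ (etrans (esym E1) (etrans _ E2))).
  by rewrite !opprB; ring.
have W a : 0 < a < h -> 0 <= a <= h by case/andP => ? ?; rewrite !ltW.
have [_ b1 _] := box s t (W _ sh) (W _ th).
have [_ _ b2] := box t' s' (W _ th') (W _ sh').
suff : `|A x - B x| < e + e by rewrite /e -splitr ltxx.
have tri (a b c : R) : `|a - c| < e -> `|b - c| < e -> `|a - b| < e + e.
  move=> ac bc; rewrite -(subrKA c); apply: le_lt_trans (ler_normD _ _) _.
  by rewrite [`|c - b|]distrC ltrD.
by apply: (tri _ _ _ b1); rewrite AB.
Qed.

End Schwarz.

Lemma Cinfty_derive_commute (R : realType) (n : nat) (D : set 'rV[R]_n)
    (f : 'rV[R]_n -> R) (x u v : 'rV[R]_n) :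
  open D -> D x -> Cinfty D f -> 'D_v ('D_u f) x = 'D_u ('D_v f) x.
Proof.
move=> Do Dx Cf.
have Cd w := Cinfty_derive w Cf; have Cdd w z := Cinfty_derive z (Cd w).
apply: (derive_commute Do Dx) => [y Dy|y Dy|y Dy|y Dy||].
- by apply: diff_derivable; exact: Cinfty_diff Cf Dy.
- by apply: diff_derivable; exact: Cinfty_diff Cf Dy.
- by apply: diff_derivable; exact: Cinfty_diff (Cd u) Dy.
- by apply: diff_derivable; exact: Cinfty_diff (Cd v) Dy.
- by apply: differentiable_continuous; exact: Cinfty_diff (Cdd _ _) Dx.
- by apply: differentiable_continuous; exact: Cinfty_diff (Cdd _ _) Dx.
Qed.

(** * Charts, smooth functions and smooth vector fields *)

(** The chain rule with a name [y] for the point [g x]: rewriting [g x] inside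
    a differential is ill typed, because the filter at which the differential is
    taken depends on it. *)
Lemma is_diff_comp_at (R : realType) (U V W : normedModType R) (g : U -> V)
    (f : V -> W) (x : U) (y : V) :
  g x = y -> differentiable g x -> differentiable f y ->
  is_diff x (f \o g) ('d f y \o 'd g x).
Proof.
by move=> <- dg df; split; [exact: differentiable_comp|exact: diff_comp].
Qed.

Section Charts.
Variables (R : realType) (n : nat) (M : manifold R n).
Implicit Types (a b c : chart R n M) (U : set M) (X Y : vfield M) (p q : M).

Lemma chart_img_open a U : open U -> open (fwd a @` (U `&` dom a)).
Proof.
move=> Uo; rewrite openE => _ [q [Uq aq] <-]; rewrite /interior.
have cq : (fwd a @` dom a) (fwd a q) by exists q.
have nU : nbhs (fwd a q) (bwd a @^-1` U).
  by apply: (bwd_continuous cq); rewrite fwdK//; exact: open_nbhs_nbhs.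
have nD : nbhs (fwd a q) (fwd a @` dom a).
  by apply: open_nbhs_nbhs; split=> //; exact: codom_open.
apply: filterS2 nU nD => x /= Ux [q' aq' xE]; exists q' => //.
by split=> //; move: Ux; rewrite -xE fwdK.
Qed.

Lemma chart_imgP a U x : (fwd a @` (U `&` dom a)) x ->
  exists q, [/\ U q, dom a q, bwd a x = q & fwd a q = x].
Proof. by move=> [q [Uq aq] <-]; exists q; rewrite fwdK. Qed.

Lemma bwd_near a U q : open U -> U q -> dom a q ->
  \forall x \near fwd a q, U (bwd a x) /\ dom a (bwd a x).
Proof.
move=> Uo Uq aq.
have : nbhs (fwd a q) (fwd a @` (U `&` dom a)).
  by apply: open_nbhs_nbhs; split; [exact: chart_img_open|exists q].
by apply: filterS => x /chart_imgP[q' [Uq' aq' -> _]].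
Qed.

Lemma transition_diff a b q : atlas a -> atlas b -> dom a q -> dom b q ->
  differentiable (fwd b \o bwd a) (fwd a q).
Proof.
by move=> aA bA aq bq; apply: Cinfty_diff (transition_smooth aA bA) _; exists q.
Qed.

Lemma diff_change_chart (W : normedModType R) (f : M -> W) a b q :
  atlas a -> atlas b -> dom a q -> dom b q ->
  differentiable (f \o bwd a) (fwd a q) ->
  is_diff (fwd b q) (f \o bwd b)
    ('d (f \o bwd a) (fwd a q) \o 'd (fwd a \o bwd b) (fwd b q)).
Proof.
move=> aA bA aq bq df.
have dt := transition_diff bA aA bq aq.
have tq : (fwd a \o bwd b) (fwd b q) = fwd a q by rewrite /= fwdK.
have [dc <-] := is_diff_comp_at tq dt df.
apply: is_diff_near_eq dc.
have := bwd_near (dom_open a) aq bq.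
by apply: filterS => x [/= ax bx]; rewrite fwdK.
Qed.

(** The cocycle rule for Jacobians of transition maps. It is what makes tangent
    vectors, given by components in [chart_at], independent of that choice. *)
Lemma transition_chain a b c q v :
  atlas a -> atlas b -> atlas c -> dom a q -> dom b q -> dom c q ->
  'd (fwd c \o bwd b) (fwd b q) ('d (fwd b \o bwd a) (fwd a q) v) =
  'd (fwd c \o bwd a) (fwd a q) v.
Proof.
move=> aA bA cA aq bq cq.
have [_ tE] := @diff_change_chart _ (fwd c) _ _ _ bA aA bq aq
  (transition_diff bA cA bq cq).
exact: (esym (congr1 (@^~ v) tE)).
Qed.

Lemma transition_id a q v : dom a q -> 'd (fwd a \o bwd a) (fwd a q) v = v.
Proof.
move=> aq; have [_ ->] : is_diff (fwd a q) (fwd a \o bwd a) ('d id (fwd a q)).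
  apply: is_diff_near_eq => //.
  have : nbhs (fwd a q) (fwd a @` dom a).
    by apply: open_nbhs_nbhs; split; [exact: codom_open|exists q].
  by apply: filterS => _ [q' aq' <-] /=; rewrite fwdK.
by rewrite diff_val.
Qed.

End Charts.

Section Fields.
Variables (R : realType) (n : nat) (M : manifold R n).
Implicit Types (a b c : chart R n M) (U : set M) (X Y : vfield M) (p q : M).

Lemma sub_smooth_fun U U' (f : M -> R) :
  U `<=` U' -> smooth_fun U' f -> smooth_fun U f.
Proof.
move=> UU' sf a aA; apply: Cinfty_sub (sf a aA).
by move=> _ [q [Uq aq] <-]; exists q => //; split=> //; exact: UU'.
Qed.

Lemma sub_smooth_vfield U U' X :
  U `<=` U' -> smooth_vfield U' X -> smooth_vfield U X.
Proof.
move=> UU' sX a aA; apply: Cinfty_sub (sX a aA).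
by move=> _ [q [Uq aq] <-]; exists q => //; split=> //; exact: UU'.
Qed.

Lemma smooth_fun_cst U (c : R) : open U -> smooth_fun U (cst c).
Proof. by move=> Uo a aA; apply: Cinfty_cst; exact: chart_img_open. Qed.

Lemma coordsD a p (v w : tangent p) : coords a (v + w) = coords a v + coords a w.
Proof. exact: linearD. Qed.

Lemma coordsZ a p k (v : tangent p) : coords a (k *: v) = k *: coords a v.
Proof. exact: linearZ. Qed.

Lemma smooth_vfieldD U X Y : open U -> smooth_vfield U X -> smooth_vfield U Y ->
  smooth_vfield U (fun q => X q + Y q).
Proof.
move=> Uo sX sY a aA; have iU := chart_img_open (a:=a) Uo.
apply: eq_Cinfty (CinftyD iU (sX a aA) (sY a aA)) iU _ => x _.
by rewrite /vfield_in coordsD.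
Qed.

Lemma smooth_vfieldZ U (f : M -> R) X : open U -> smooth_fun U f ->
  smooth_vfield U X -> smooth_vfield U (fun q => f q *: X q).
Proof.
move=> Uo sf sX a aA; have iU := chart_img_open (a:=a) Uo.
apply: eq_Cinfty (CinftyZ iU (sf a aA) (sX a aA)) iU _ => x _.
by rewrite /vfield_in coordsZ.
Qed.

Lemma smooth_vfield_sum U m (X : 'I_m -> vfield M) : open U ->
  (forall i, smooth_vfield U (X i)) ->
  smooth_vfield U (fun q => \sum_(i < m) X i q).
Proof.
move=> Uo sX a aA; have iU := chart_img_open (a:=a) Uo.
apply: eq_Cinfty (Cinfty_sum iU (fun i => sX i a aA)) iU _ => x _.
by rewrite fct_sumE /vfield_in /coords linear_sum.
Qed.

Lemma dirderE a p (v : tangent p) (f : M -> R) : atlas a -> dom a p ->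
  differentiable (f \o bwd a) (fwd a p) ->
  dirder v f = 'd (f \o bwd a) (fwd a p) (coords a v).
Proof.
move=> aA ap df; rewrite /dirder.
have [_ fE] := @diff_change_chart _ _ _ _ f _ _ _ aA (chart_at_atlas p) ap
  (chart_at_dom p) df.
exact: (congr1 (@^~ v) fE).
Qed.

Lemma smooth_fun_diff U (f : M -> R) a q : smooth_fun U f -> atlas a ->
  U q -> dom a q -> differentiable (f \o bwd a) (fwd a q).
Proof. by move=> sf aA Uq aq; apply: Cinfty_diff (sf a aA) _; exists q. Qed.

Lemma dirder_local U p (v : tangent p) (f g : M -> R) : open U -> U p ->
  smooth_fun U f -> {in U, f =1 g} -> dirder v f = dirder v g.
Proof.
move=> Uo Up sf fg; rewrite /dirder.
have df := smooth_fun_diff sf (chart_at_atlas p) Up (chart_at_dom p).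
have fg' : {near fwd (chart_at p) p,
    f \o bwd (chart_at p) =1 g \o bwd (chart_at p)}.
  have := bwd_near Uo Up (chart_at_dom p).
  by apply: filterS => x [Ux _] /=; apply: fg; rewrite inE.
have [_ fE] := is_diff_near_eq fg' df.
exact: (esym (congr1 (@^~ v) fE)).
Qed.

(** In coordinates Xf is the sum of the products X^j d_j f, which exhibits
    it as a smooth function. *)
Lemma dirder_field_inE U X (f : M -> R) a : smooth_fun U f -> atlas a ->
  {in fwd a @` (U `&` dom a), (fun q => dirder (X q) f) \o bwd a =1
    \sum_(j < n) ((fun x => vfield_in a X x 0 j) *
                  'D_(delta_mx 0 j) (f \o bwd a))}.
Proof.
move=> sf aA x /[1!inE] /chart_imgP[q [Uq aq xq qx]].
have df := smooth_fun_diff sf aA Uq aq.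
rewrite /= /vfield_in xq (dirderE _ aA aq df) diff_row// fct_sumE.
by apply: eq_bigr => j _; rewrite qx -xq.
Qed.

Lemma smooth_dirder U X (f : M -> R) : open U -> smooth_vfield U X ->
  smooth_fun U f -> smooth_fun U (fun q => dirder (X q) f).
Proof.
move=> Uo sX sf a aA; have iU := chart_img_open (a:=a) Uo.
pose g := \sum_(j < n) ((fun x => vfield_in a X x 0 j) *
                  'D_(delta_mx 0 j) (f \o bwd a)).
suff Cg : Cinfty (fwd a @` (U `&` dom a)) g.
  by apply: eq_Cinfty Cg iU _ => x /(dirder_field_inE X sf aA) ->.
apply: (Cinfty_sum iU) => j; apply: (CinftyM iU).
  exact: Cinfty_entry iU (sX a aA).
exact: Cinfty_derive (sf a aA).
Qed.

(** The second-order terms of X(Yf) and Y(Xf) agree by symmetry of second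
    derivatives, and the first-order terms give the bracket. *)
Lemma dirder_bracket U X Y (f : M -> R) p : open U -> U p ->
  smooth_vfield U X -> smooth_vfield U Y -> smooth_fun U f ->
  dirder (bracket X Y p) f =
    dirder (X p) (fun q => dirder (Y q) f)
    - dirder (Y p) (fun q => dirder (X q) f).
Proof.
move=> Uo Up sX sY sf; set a := chart_at p.
have aA : atlas a := chart_at_atlas p.
have ap : dom a p := chart_at_dom p.
have iU := chart_img_open (a:=a) Uo.
have ix : (fwd a @` (U `&` dom a)) (fwd a p) by exists p.
set x := fwd a p in ix *; set F := f \o bwd a.
have CF : Cinfty (fwd a @` (U `&` dom a)) F := sf a aA.
have second Z (Z' : vfield M) : smooth_vfield U Z ->
    dirder (Z' p) (fun q => dirder (Z q) f) =
    \sum_(j < n) (vfield_in a Z x 0 j * 'd ('D_(delta_mx 0 j) F) x (Z' p))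
    + 'd F x ('d (vfield_in a Z) x (Z' p)).
  move=> sZ; have CZ := sZ a aA.
  have dZ := Cinfty_diff CZ ix; have dF := Cinfty_diff CF ix.
  have dDF j := Cinfty_diff (Cinfty_derive (delta_mx 0 j) CF) ix.
  have dZj j := Cinfty_diff (Cinfty_entry j iU CZ) ix.
  (* [g] is the coordinate expression of Zf; Leibniz' rule splits its
     derivative into the two sums of the claim. *)
  pose g := \sum_(j < n) ((fun x => vfield_in a Z x 0 j) *
                  'D_(delta_mx 0 j) F).
  have dg : differentiable g x.
    by apply: differentiable_sum => j; exact: differentiableM.
  have gE : {near x, g =1 (fun q => dirder (Z q) f) \o bwd a}.
    by apply: (open_near_eq iU ix) => y /(dirder_field_inE Z sf aA) ->.
  rewrite /dirder -/a -/x.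
  have [_ E] := is_diff_near_eq gE dg.
  transitivity ('d g x (Z' p)); first exact: (congr1 (@^~ (Z' p)) E).
  rewrite -deriveE// derive_sum; last first.
    by move=> j; apply: diff_derivable; exact: differentiableM.
  rewrite (diff_row _ dF) -big_split; apply: eq_bigr => j _.
  rewrite deriveM; [|exact: diff_derivable..].
  rewrite -(deriveE _ (dDF j)) -(deriveE _ dZ) -derive_entry//.
  by rewrite /=; congr (_ + _); exact: mulrC.
have vfx (Z : vfield M) : vfield_in a Z x = Z p.
  by rewrite /vfield_in /x fwdK// /coords transition_id.
have sym (u v : 'rV[R]_n) : \sum_(j < n) (u 0 j * 'd ('D_(delta_mx 0 j) F) x v) =
               \sum_(j < n) (v 0 j * 'd ('D_(delta_mx 0 j) F) x u).
  have dDF j := Cinfty_diff (Cinfty_derive (delta_mx 0 j) CF) ix.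
  under eq_bigr do rewrite (diff_row _ (dDF _)) mulr_sumr.
  under [RHS]eq_bigr do rewrite (diff_row _ (dDF _)) mulr_sumr.
  rewrite exchange_big; apply: eq_bigr => j _; apply: eq_bigr => k _ /=.
  by rewrite (Cinfty_derive_commute _ _ iU ix CF); exact: mulrCA.
rewrite (second Y X sY) (second X Y sX) !vfx sym opprD addrACA subrr add0r.
by rewrite /dirder -linearB.
Qed.

End Fields.

(** * Coordinate fields and tensorial operators *)

Section Frames.
Variables (R : realType) (n : nat) (M : manifold R n).
Implicit Types (a b : chart R n M) (U : set M) (X Y : vfield M) (p q : M).

(** The field on the domain of [a] with constant components [v] in the chart
    [a]. Its value at [q] is carried to the chart that represents T_qM. *)
Definition const_field a (v : 'rV[R]_n) : vfield M := fun q =>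
  'd (fwd (chart_at q) \o bwd a) (fwd a q) v.

Lemma coords_const_field a b v q : atlas a -> atlas b -> dom a q -> dom b q ->
  coords b (const_field a v q) = 'd (fwd b \o bwd a) (fwd a q) v.
Proof.
move=> aA bA aq bq.
exact: transition_chain aA (chart_at_atlas q) bA aq (chart_at_dom q) bq.
Qed.

Lemma const_field_coords a q (w : tangent q) : atlas a -> dom a q ->
  const_field a (coords a w) q = w.
Proof.
move=> aA aq; rewrite /const_field /coords.
have cA := chart_at_atlas q; have cq := chart_at_dom q.
by rewrite (transition_chain w cA aA cA cq aq cq) transition_id.
Qed.

Lemma const_field_at p (v : tangent p) : const_field (chart_at p) v p = v.
Proof. by rewrite /const_field transition_id//; exact: chart_at_dom. Qed.

(** In another chart [b] the field has the components of D_v of the transition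
    map from [a] to [b], taken at the point with [a]-coordinates
    [(fwd a \o bwd b) x]. *)
Lemma smooth_const_field a v : atlas a -> smooth_vfield (dom a) (const_field a v).
Proof.
move=> aA b bA.
have iab := chart_img_open (a:=b) (dom_open a).
have iba := chart_img_open (a:=a) (dom_open b).
pose t x := 'D_v (fwd b \o bwd a) x.
have Ct : Cinfty (fwd a @` (dom b `&` dom a)) t.
  by rewrite setIC; apply: Cinfty_derive; exact: transition_smooth.
have Cba : Cinfty (fwd b @` (dom a `&` dom b)) (fwd a \o bwd b).
  by rewrite setIC; exact: transition_smooth.
have imba x : (fwd b @` (dom a `&` dom b)) x ->
    (fwd a @` (dom b `&` dom a)) ((fwd a \o bwd b) x).
  by move=> /chart_imgP[q [aq bq xq _]]; exists q; rewrite //= xq.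
apply: eq_Cinfty (Cinfty_comp iab iba imba Cba Ct) iab _.
move=> x /[1!inE] /chart_imgP[q [aq bq xq qx]].
have dt := transition_diff aA bA aq bq.
by rewrite /vfield_in /= xq /t (deriveE v dt) coords_const_field.
Qed.

Lemma vfield_expand a X q : atlas a -> dom a q ->
  X q = \sum_(i < n) coords a (X q) 0 i *: const_field a (delta_mx 0 i) q.
Proof.
move=> aA aq; rewrite -[LHS](const_field_coords (X q) aA aq).
rewrite /const_field {1}[coords a (X q)]row_delta_sum linear_sum.
by apply: eq_bigr => i _; rewrite linearZ.
Qed.

Lemma smooth_component U a X i : atlas a -> open U -> smooth_vfield U X ->
  smooth_fun (U `&` dom a) (fun q => coords a (X q) 0 i).
Proof.
move=> aA Uo sX b bA.
have Vo : open (U `&` dom a) by apply: openI => //; exact: dom_open.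
have ib := chart_img_open (a:=b) Vo; have ia := chart_img_open (a:=a) Uo.
have Cba : Cinfty (fwd b @` (U `&` dom a `&` dom b)) (fwd a \o bwd b).
  apply: Cinfty_sub (transition_smooth bA aA).
  by move=> _ [q [[_ aq] bq] <-]; exists q.
have imba x : (fwd b @` (U `&` dom a `&` dom b)) x ->
    (fwd a @` (U `&` dom a)) ((fwd a \o bwd b) x).
  by move=> /chart_imgP[q [[Uq aq] bq xq _]]; exists q; rewrite //= xq.
have CX := Cinfty_entry i ia (sX a aA).
apply: eq_Cinfty (Cinfty_comp_scalar ib imba Cba CX) ib _.
move=> x /[1!inE] /chart_imgP[q [[Uq aq] bq xq qx]].
by rewrite /= /vfield_in xq fwdK.
Qed.

(** Over the domain of a chart, X is the sum of X^i E_i with smooth X^i and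
    coordinate fields E_i, hence A X is the sum of X^i(p) A E_i and involves X
    only through X p. *)
Lemma tensorial (L : lmodType R) (A : vfield M -> L) U p :
  open U -> U p -> U `<=` dom (chart_at p) ->
  (forall X X', smooth_vfield U X -> smooth_vfield U X' ->
    (forall q, U q -> X q = X' q) -> A X = A X') ->
  (forall X X', smooth_vfield U X -> smooth_vfield U X' ->
    A (fun q => X q + X' q) = A X + A X') ->
  (forall f X, smooth_fun U f -> smooth_vfield U X ->
    A (fun q => f q *: X q) = f p *: A X) ->
  forall X X', smooth_vfield U X -> smooth_vfield U X' -> X p = X' p ->
  A X = A X'.
Proof.
move=> Uo Up Ua Aloc Aadd Ascale; set a := chart_at p.
have aA : atlas a := chart_at_atlas p.
have sE v : smooth_vfield U (const_field a v).
  exact: sub_smooth_vfield Ua (smooth_const_field v aA).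
have Asum m (F : 'I_m -> vfield M) : (forall i, smooth_vfield U (F i)) ->
    A (fun q => \sum_(i < m) F i q) = \sum_(i < m) A (F i).
  elim: m F => [|m IHm] F sF.
    rewrite big_ord0 -[RHS](scale0r (A (const_field a 0))).
    rewrite -(Ascale (cst 0) _ (smooth_fun_cst 0 Uo) (sE 0)).
    congr A; apply/functional_extensionality_dep => q.
    by rewrite big_ord0 scale0r.
  rewrite big_ord_recr /= -IHm// -Aadd//; last exact: smooth_vfield_sum.
  congr A; apply/functional_extensionality_dep => q.
  by rewrite big_ord_recr.
suff AE X : smooth_vfield U X ->
    A X = \sum_(i < n) coords a (X p) 0 i *: A (const_field a (delta_mx 0 i)).
  by move=> X X' sX sX' XX'; rewrite (AE X sX) (AE X' sX') XX'.
move=> sX.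
have sf i : smooth_fun U (fun q => coords a (X q) 0 i).
  apply: sub_smooth_fun (smooth_component i aA Uo sX).
  by move=> q Uq; split=> //; exact: Ua.
pose F i : vfield M := fun q =>
  coords a (X q) 0 i *: const_field a (delta_mx 0 i) q.
have sF i : smooth_vfield U (F i) by apply: smooth_vfieldZ.
rewrite (Aloc X (fun q => \sum_(i < n) F i q) sX).
- by rewrite Asum//; apply: eq_bigr => i _; rewrite Ascale.
- exact: smooth_vfield_sum.
- by move=> q Uq; apply: vfield_expand => //; exact: Ua.
Qed.

End Frames.

(** * Tensoriality and symmetries of the curvature *)

Section Connection.
Variables (R : realType) (n : nat) (M : manifold R n) (nabla : covder M).
Hypothesis nablaP : is_connection nabla.
Variables (U : set M) (Uo : open U).
Implicit Types (X Y Z : vfield M) (p q : M) (f : M -> R).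

Lemma covderDl p (v w : tangent p) Z : U p -> smooth_vfield U Z ->
  nabla (v + w) Z = nabla v Z + nabla w Z.
Proof.
by move=> Up sZ;
  rewrite -[v]scale1r (nabla_linear nablaP 1 _ _ Uo Up sZ) !scale1r.
Qed.

Lemma covder0l p Z : U p -> smooth_vfield U Z -> nabla (0 : tangent p) Z = 0.
Proof.
move=> Up sZ; apply: (addrI (nabla (0 : tangent p) Z)).
by rewrite -covderDl// !addr0.
Qed.

Lemma covderZl p k (v : tangent p) Z : U p -> smooth_vfield U Z ->
  nabla (k *: v) Z = k *: nabla v Z.
Proof.
move=> Up sZ; rewrite -[k *: v]addr0 (nabla_linear nablaP _ _ _ Uo Up sZ).
by rewrite covder0l// addr0.
Qed.

Lemma covderBl p (v w : tangent p) Z : U p -> smooth_vfield U Z ->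
  nabla (v - w) Z = nabla v Z - nabla w Z.
Proof. by move=> Up sZ; rewrite covderDl// -scaleN1r covderZl// scaleN1r. Qed.

End Connection.

Section Metric.
Variables (R : realType) (n : nat) (M : riemannian_manifold R n) (p : M).
Implicit Types u v w : tangent p.

Lemma metricDl u v w :
  metric M (u + v) w = metric M u w + metric M v w.
Proof. by rewrite -[u]scale1r (metric_linear (metricP M)) scale1r mul1r. Qed.

Lemma metric0l w : metric M 0 w = 0.
Proof. by apply: (addrI (metric M 0 w)); rewrite -metricDl !addr0. Qed.

Lemma metricZl k u w : metric M (k *: u) w = k * metric M u w.
Proof.
by rewrite -[k *: u]addr0 (metric_linear (metricP M)) metric0l addr0.
Qed.

Lemma metricC u v : metric M u v = metric M v u.
Proof. exact: (Defs.metric_sym (metricP M)). Qed.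

Lemma metricBl u v w :
  metric M (u - v) w = metric M u w - metric M v w.
Proof. by rewrite metricDl -[- v]scaleN1r metricZl mulN1r. Qed.

Lemma metricDr u v w :
  metric M w (u + v) = metric M w u + metric M w v.
Proof. by rewrite metricC metricDl !(metricC w). Qed.

Lemma metricZr k u w : metric M w (k *: u) = k * metric M w u.
Proof. by rewrite metricC metricZl (metricC w). Qed.

End Metric.

Section Curvature.
Variables (R : realType) (n : nat) (M : riemannian_manifold R n).
Variables (nabla : covder M).
Hypothesis nablaP : is_levi_civita nabla.
Implicit Types (U : set M) (X Y Z : vfield M) (p q : M) (f : M -> R).

Let connP : is_connection nabla := levi_civita_connection nablaP.

Section OnOpen.
Variables (U : set M) (Uo : open U).

Lemma smooth_covder X Z : smooth_vfield U X -> smooth_vfield U Z ->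
  smooth_vfield U (fun q => nabla (X q) Z).
Proof. by move=> sX sZ; apply: (nabla_smooth connP). Qed.

Lemma curvature_local p X Y Z X' Y' Z' : U p ->
  smooth_vfield U X -> smooth_vfield U Y -> smooth_vfield U Z ->
  smooth_vfield U X' -> smooth_vfield U Y' -> smooth_vfield U Z' ->
  (forall q, U q -> X q = X' q) -> (forall q, U q -> Y q = Y' q) ->
  (forall q, U q -> Z q = Z' q) ->
  curvature nabla X Y Z p = curvature nabla X' Y' Z' p.
Proof.
move=> Up sX sY sZ sX' sY' sZ' XX' YY' ZZ'.
have loc v W W' : smooth_vfield U W -> smooth_vfield U W' ->
    (forall q, U q -> W q = W' q) -> nabla (p:=p) v W = nabla v W'.
  exact: (nabla_local connP _ Uo Up).
have loc2 V V' : smooth_vfield U V -> smooth_vfield U V' ->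
    (forall q, U q -> V q = V' q) -> forall v, nabla (p:=p) v
      (fun q => nabla (V q) Z) = nabla v (fun q => nabla (V' q) Z').
  move=> sV sV' VV' v; apply: loc; [exact: smooth_covder..|] => q Uq.
  by rewrite VV'//; apply: (nabla_local connP _ Uo Uq).
rewrite /curvature -!(torsion_free nablaP Uo Up)//.
rewrite (loc2 _ _ sY sY')// (loc2 _ _ sX sX')// (loc _ _ _ sY sY')//.
by rewrite (loc _ _ _ sX sX')// (loc _ _ _ sZ sZ')// XX'// YY'.
Qed.

Lemma bracket_antisym X Y p : bracket Y X p = - bracket X Y p.
Proof. by rewrite /bracket opprB. Qed.

Lemma curvature_antisym p X Y Z : U p -> smooth_vfield U Z ->
  curvature nabla Y X Z p = - curvature nabla X Y Z p.
Proof.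
move=> Up sZ; rewrite /curvature (bracket_antisym X Y) -[- bracket X Y p]sub0r.
rewrite (covderBl connP Uo)// (covder0l connP Uo)//.
by apply/rowP => i; rewrite !mxE; ring.
Qed.

Lemma curvatureDr p X Y Z Z' : U p ->
  smooth_vfield U X -> smooth_vfield U Y ->
  smooth_vfield U Z -> smooth_vfield U Z' ->
  curvature nabla X Y (fun q => Z q + Z' q) p =
  curvature nabla X Y Z p + curvature nabla X Y Z' p.
Proof.
move=> Up sX sY sZ sZ'; have sZZ' := smooth_vfieldD Uo sZ sZ'.
have nab2 v V : smooth_vfield U V ->
    nabla (p:=p) v (fun q => nabla (V q) (fun q => Z q + Z' q)) =
    nabla v (fun q => nabla (V q) Z) + nabla v (fun q => nabla (V q) Z').
  move=> sV; have sVZ := smooth_covder sV sZ; have sVZ' := smooth_covder sV sZ'.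
  rewrite -(nabla_add connP v Uo Up sVZ sVZ').
  apply: (nabla_local connP v Uo Up);
    [exact: smooth_covder|exact: smooth_vfieldD|].
  by move=> q Uq; exact: (nabla_add connP _ Uo Uq).
rewrite /curvature !nab2// (nabla_add connP _ Uo Up sZ sZ').
by apply/rowP => i; rewrite !mxE; ring.
Qed.

(** Expanding nabla_X nabla_Y (fZ) - nabla_Y nabla_X (fZ) by Leibniz' rule, the
    first derivatives of f cancel and X(Yf) - Y(Xf) remains as coefficient of
    Z; it is compensated by nabla_[X,Y] (fZ). *)
Lemma curvatureZr p f X Y Z : U p -> smooth_fun U f ->
  smooth_vfield U X -> smooth_vfield U Y -> smooth_vfield U Z ->
  curvature nabla X Y (fun q => f q *: Z q) p = f p *: curvature nabla X Y Z p.
Proof.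
move=> Up sf sX sY sZ; have sfZ := smooth_vfieldZ Uo sf sZ.
have nab2 v V : smooth_vfield U V ->
    nabla (p:=p) v (fun q => nabla (V q) (fun q => f q *: Z q)) =
    (dirder v (fun q => dirder (V q) f) *: Z p + dirder (V p) f *: nabla v Z)
    + (dirder v f *: nabla (V p) Z + f p *: nabla v (fun q => nabla (V q) Z)).
  move=> sV; have sVf := smooth_dirder Uo sV sf.
  have sVZ := smooth_covder sV sZ.
  rewrite -(nabla_leibniz connP v Uo Up sVf sZ).
  rewrite -(nabla_leibniz connP v Uo Up sf sVZ).
  have s1 := smooth_vfieldZ Uo sVf sZ; have s2 := smooth_vfieldZ Uo sf sVZ.
  rewrite -(nabla_add connP v Uo Up s1 s2).
  apply: (nabla_local connP v Uo Up);
    [exact: smooth_covder|exact: smooth_vfieldD|].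
  by move=> q Uq; exact: (nabla_leibniz connP _ Uo Uq).
rewrite /curvature !nab2// (nabla_leibniz connP _ Uo Up sf sZ).
rewrite (dirder_bracket Uo Up sX sY sf).
by apply/rowP => i; rewrite !mxE; ring.
Qed.

Lemma curvatureDl p X X' Y Z : U p ->
  smooth_vfield U X -> smooth_vfield U X' ->
  smooth_vfield U Y -> smooth_vfield U Z ->
  curvature nabla (fun q => X q + X' q) Y Z p =
  curvature nabla X Y Z p + curvature nabla X' Y Z p.
Proof.
move=> Up sX sX' sY sZ; have sXX' := smooth_vfieldD Uo sX sX'.
have sYZ := smooth_covder sY sZ.
have sXZ := smooth_covder sX sZ; have sXZ' := smooth_covder sX' sZ.
have nab2 : nabla (Y p) (fun q => nabla (X q + X' q) Z) =
    nabla (Y p) (fun q => nabla (X q) Z) + nabla (Y p) (fun q => nabla (X' q) Z).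
  rewrite -(nabla_add connP _ Uo Up sXZ sXZ').
  apply: (nabla_local connP _ Uo Up);
    [exact: smooth_covder|exact: smooth_vfieldD|].
  by move=> q Uq; exact: (covderDl connP Uo).
have brD : bracket (fun q => X q + X' q) Y p = bracket X Y p + bracket X' Y p.
  rewrite -!(torsion_free nablaP Uo Up)// (covderDl connP Uo)//.
  by rewrite (nabla_add connP _ Uo Up sX sX') opprD addrACA.
rewrite /curvature brD nab2 (covderDl connP Uo (X p) (X' p) Up sYZ).
rewrite (covderDl connP Uo (bracket X Y p) (bracket X' Y p) Up sZ).
(* The brackets become atoms, so that they are not compared by unfolding. *)
move: (bracket X Y p) (bracket X' Y p) => B B'.
by apply/rowP => i; rewrite !mxE; ring.
Qed.

(** The derivative of f in nabla_Y (f nabla_X Z) is compensated by the one in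
    [fX, Y] = f [X, Y] - (Yf) X. The latter formula, like the additivity of the
    bracket, is read off from the absence of torsion, which reduces it to
    Leibniz' rule for nabla. *)
Lemma curvatureZl p f X Y Z : U p -> smooth_fun U f ->
  smooth_vfield U X -> smooth_vfield U Y -> smooth_vfield U Z ->
  curvature nabla (fun q => f q *: X q) Y Z p = f p *: curvature nabla X Y Z p.
Proof.
move=> Up sf sX sY sZ; have sfX := smooth_vfieldZ Uo sf sX.
have sXZ := smooth_covder sX sZ; have sYZ := smooth_covder sY sZ.
have nab2 : nabla (Y p) (fun q => nabla (f q *: X q) Z) =
    dirder (Y p) f *: nabla (X p) Z
    + f p *: nabla (Y p) (fun q => nabla (X q) Z).
  rewrite -(nabla_leibniz connP _ Uo Up sf sXZ).
  apply: (nabla_local connP _ Uo Up);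
    [exact: smooth_covder|exact: smooth_vfieldZ|].
  by move=> q Uq; exact: (covderZl connP Uo).
have brZ : bracket (fun q => f q *: X q) Y p =
    f p *: bracket X Y p - dirder (Y p) f *: X p.
  rewrite -!(torsion_free nablaP Uo Up)// (covderZl connP Uo)//.
  rewrite (nabla_leibniz connP _ Uo Up sf sX).
  by apply/rowP => i; rewrite !mxE; ring.
rewrite /curvature brZ nab2.
rewrite (covderBl connP Uo (f p *: bracket X Y p) (dirder (Y p) f *: X p) Up sZ).
rewrite (covderZl connP Uo (f p) (X p) Up sYZ) !(covderZl connP Uo _ _ Up sZ).
by apply/rowP => i; rewrite !mxE; ring.
Qed.

(** With h = <Z, Z>, metric compatibility gives
    X(Yh) - Y(Xh) = 2 <nabla_X nabla_Y Z - nabla_Y nabla_X Z, Z>, since the terms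
    in <nabla_X Z, nabla_Y Z> cancel, and [X, Y]h = 2 <nabla_[X,Y] Z, Z>. The
    left-hand sides are equal. *)
Lemma curvature_skew p X Y Z : U p ->
  smooth_vfield U X -> smooth_vfield U Y -> smooth_vfield U Z ->
  metric M (curvature nabla X Y Z p) (Z p) = 0.
Proof.
move=> Up sX sY sZ; pose h q := metric M (Z q) (Z q).
have sh : smooth_fun U h by apply: (metric_smooth (metricP M)).
have dh q (v : tangent q) : U q ->
    dirder v h = metric M (nabla v Z + nabla v Z) (Z q).
  move=> Uq; rewrite (metric_compatible nablaP v Uo Uq sZ sZ) metricDl.
  by rewrite [X in _ + X = _]metricC.
have ddh v V : smooth_vfield U V -> dirder (p:=p) v (fun q => dirder (V q) h) =
    2 * (metric M (nabla v (fun q => nabla (V q) Z)) (Z p)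
         + metric M (nabla (V p) Z) (nabla v Z)).
  move=> sV; have sVZ := smooth_covder sV sZ.
  (* Writing Vh as <2 nabla_V Z, Z> lets metric compatibility be applied to
     it a second time. *)
  have sVZ2 := smooth_vfieldD Uo sVZ sVZ.
  rewrite (@dirder_local _ _ _ U _ _ _
    (fun q => metric M (nabla (V q) Z + nabla (V q) Z) (Z q)) Uo Up).
  - rewrite (metric_compatible nablaP v Uo Up sVZ2 sZ).
    by rewrite (nabla_add connP v Uo Up sVZ sVZ) !metricDl; ring.
  - exact: smooth_dirder.
  - by move=> q /[1!inE] Uq; exact: dh.
have := dirder_bracket Uo Up sX sY sh.
rewrite dh// (ddh _ _ sX) (ddh _ _ sY) /curvature metricDl !metricBl.
rewrite (metricC (nabla (X p) Z)).
move: (metric M (nabla (bracket X Y p) Z) (Z p)) => br.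
move: (metric M (nabla (Y p) Z) (nabla (X p) Z)) => mixed.
move: (metric M (nabla (X p) _) (Z p)) (metric M (nabla (Y p) _) (Z p)) => A B E.
lra.
Qed.

Lemma curvature_tensorr p X Y Z Z' : U p -> U `<=` dom (chart_at p) ->
  smooth_vfield U X -> smooth_vfield U Y ->
  smooth_vfield U Z -> smooth_vfield U Z' -> Z p = Z' p ->
  curvature nabla X Y Z p = curvature nabla X Y Z' p.
Proof.
move=> Up Ua sX sY sZ sZ' ZZ'; pose A W := curvature nabla X Y W p.
change (A Z = A Z').
apply: (tensorial (A := A) Uo Up Ua _ _ _ sZ sZ' ZZ').
- by move=> W W' sW sW' WW'; exact: curvature_local.
- by move=> W W' sW sW'; exact: curvatureDr.
- by move=> f W sf sW; exact: curvatureZr.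
Qed.

Lemma curvature_tensorl p X X' Y Z : U p -> U `<=` dom (chart_at p) ->
  smooth_vfield U Y -> smooth_vfield U Z ->
  smooth_vfield U X -> smooth_vfield U X' -> X p = X' p ->
  curvature nabla X Y Z p = curvature nabla X' Y Z p.
Proof.
move=> Up Ua sY sZ sX sX' XX'; pose A W := curvature nabla W Y Z p.
change (A X = A X').
apply: (tensorial (A := A) Uo Up Ua _ _ _ sX sX' XX').
- by move=> W W' sW sW' WW'; exact: curvature_local.
- by move=> W W' sW sW'; exact: curvatureDl.
- by move=> f W sf sW; exact: curvatureZl.
Qed.

End OnOpen.

Lemma curvature_tensor p U U' X Y Z X' Y' Z' :
  open U -> U p -> open U' -> U' p ->
  smooth_vfield U X -> smooth_vfield U Y -> smooth_vfield U Z ->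
  smooth_vfield U' X' -> smooth_vfield U' Y' -> smooth_vfield U' Z' ->
  X p = X' p -> Y p = Y' p -> Z p = Z' p ->
  curvature nabla X Y Z p = curvature nabla X' Y' Z' p.
Proof.
move=> Uo Up Uo' Up' sX0 sY0 sZ0 sX0' sY0' sZ0' XX' YY' ZZ'.
pose V := U `&` U' `&` dom (chart_at p).
have Vo : open V by apply: openI; [exact: openI|exact: dom_open].
have Vp : V p by split=> //; exact: chart_at_dom.
have Va : V `<=` dom (chart_at p) by move=> q [].
have VU : V `<=` U by move=> q [[]].
have VU' : V `<=` U' by move=> q [[]].
have sX := sub_smooth_vfield VU sX0; have sX' := sub_smooth_vfield VU' sX0'.
have sY := sub_smooth_vfield VU sY0; have sY' := sub_smooth_vfield VU' sY0'.
have sZ := sub_smooth_vfield VU sZ0; have sZ' := sub_smooth_vfield VU' sZ0'.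
rewrite (curvature_tensorr Vo Vp Va sX sY sZ sZ' ZZ').
rewrite (curvature_tensorl Vo Vp Va sY sZ' sX sX' XX').
rewrite (curvature_antisym Vo Y X' Vp sZ') (curvature_antisym Vo Y' X' Vp sZ').
by rewrite (curvature_tensorl Vo Vp Va sX' sZ' sY sY' YY').
Qed.

(** Tensoriality says that every value of the curvature of extensions belongs
    to the set from which [riemann] picks an element, so the pick is that
    value. *)
Lemma riemannE p U X Y Z : open U -> U p ->
  smooth_vfield U X -> smooth_vfield U Y -> smooth_vfield U Z ->
  riemann nabla (X p) (Y p) (Z p) = curvature nabla X Y Z p.
Proof.
move=> Uo Up sX sY sZ; rewrite /riemann; set S := (S in get S).
have SR : S (curvature nabla X Y Z p).
  move=> U' X' Y' Z' Uo' Up' sX' sY' sZ' XX' YY' ZZ'.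
  exact: (curvature_tensor Uo' Up' Uo Up).
have /(_ U X Y Z Uo Up sX sY sZ erefl erefl erefl) := getPex (ex_intro _ _ SR).
by move=> ->.
Qed.

Section AtPoint.
Variable p : M.
Implicit Types x y z : tangent p.

Let a := chart_at p.
Let aA : atlas a := chart_at_atlas p.
Let ap : dom a p := chart_at_dom p.
Let ao : open (dom a) := dom_open a.
Let E (v : tangent p) := const_field a v.
Let sE v : smooth_vfield (dom a) (E v) := smooth_const_field v aA.
Let EE (v : tangent p) : E v p = v := const_field_at v.

Lemma riemann_const_field x y z :
  riemann nabla x y z = curvature nabla (E x) (E y) (E z) p.
Proof. by rewrite -(riemannE ao ap)// !EE. Qed.

Lemma riemann_antisym x y z : riemann nabla y x z = - riemann nabla x y z.
Proof. by rewrite !riemann_const_field (curvature_antisym ao). Qed.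

Lemma riemannDr x y z z' :
  riemann nabla x y (z + z') = riemann nabla x y z + riemann nabla x y z'.
Proof.
have := riemannE ao ap (sE x) (sE y) (smooth_vfieldD ao (sE z) (sE z')).
by rewrite /= !EE (curvatureDr ao)// -!riemann_const_field.
Qed.

Lemma riemannZr k x y z : riemann nabla x y (k *: z) = k *: riemann nabla x y z.
Proof.
have sk := smooth_fun_cst k ao.
have := riemannE ao ap (sE x) (sE y) (smooth_vfieldZ ao sk (sE z)).
by rewrite /= !EE (curvatureZr ao ap sk)// -!riemann_const_field.
Qed.

Lemma riemannDl x x' y z :
  riemann nabla (x + x') y z = riemann nabla x y z + riemann nabla x' y z.
Proof.
have := riemannE ao ap (smooth_vfieldD ao (sE x) (sE x')) (sE y) (sE z).
by rewrite /= !EE (curvatureDl ao)// -!riemann_const_field.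
Qed.

Lemma riemannZl k x y z : riemann nabla (k *: x) y z = k *: riemann nabla x y z.
Proof.
have sk := smooth_fun_cst k ao.
have := riemannE ao ap (smooth_vfieldZ ao sk (sE x)) (sE y) (sE z).
by rewrite /= !EE (curvatureZl ao ap sk)// -!riemann_const_field.
Qed.

Lemma riemann_skew x y z : metric M (riemann nabla x y z) z = 0.
Proof.
rewrite riemann_const_field -{2}(EE z); exact: (curvature_skew ao).
Qed.

End AtPoint.
End Curvature.

(** * The singular value problem *)

Section SingularValue.
Variables (R : realType) (n : nat) (M : riemannian_manifold R n).
Variables (nabla : covder M).
Hypothesis nablaP : is_levi_civita nabla.
Variables (p : M) (sigma : R).
Implicit Types W X Y Z : tangent p.

Lemma solves_svp_swap W X Y Z :
  solves_svp nabla W X Y Z sigma -> solves_svp nabla X W Z Y sigma.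
Proof. by case=> -[? ? ? ?] [? ? ? ?]. Qed.

Lemma solves_svp_exchange W X Y Z :
  solves_svp nabla W X Y Z sigma -> solves_svp nabla Y Z W X sigma.
Proof. by case=> -[? ? ? ?] [? ? ? ?]. Qed.

(** sigma <W, X> = <R(Y, Z)X, X> = 0. *)
Lemma solves_svp_orthogonal W X Y Z : solves_svp nabla W X Y Z sigma ->
  (sigma = 0 -> metric M W X = 0) -> metric M W X = 0.
Proof.
case=> -[EW _ _ _] _ H0; have [/H0//|s0] := eqVneq sigma 0.
have /eqP := riemann_skew nablaP Y Z X.
by rewrite EW metricZl mulf_eq0 (negPf s0) => /eqP.
Qed.

Let r : R := (Num.sqrt 2)^-1.

Let rr : r * r = 2^-1.
Proof. by rewrite -invfM -expr2 sqr_sqrtr. Qed.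

(** R(x, y) is bilinear and alternating in (x, y), and the rotation by an eighth
    of a turn has determinant [2 * (r * r) = 1]. *)
Lemma riemann_rotate (x y z : tangent p) :
  riemann nabla (r *: (x - y)) (r *: (x + y)) z = riemann nabla x y z.
Proof.
have Zm k u v w : riemann nabla (p:=p) u (k *: v) w = k *: riemann nabla u v w.
  rewrite (riemann_antisym nablaP (k *: v)) (riemannZl nablaP).
  by rewrite (riemann_antisym nablaP u) scalerN opprK.
have Dm u v v' w : riemann nabla (p:=p) u (v + v') w =
    riemann nabla u v w + riemann nabla u v' w.
  rewrite (riemann_antisym nablaP (v + v')) (riemannDl nablaP).
  rewrite (riemann_antisym nablaP u) (riemann_antisym nablaP u v').
  by rewrite opprD !opprK.
have alt u w : riemann nabla (p:=p) u u w = 0.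
  have := riemann_antisym nablaP u u w.
  by move/eqP; rewrite -addr_eq0 -mulr2n -scaler_nat scaler_eq0 pnatr_eq0 => /eqP.
rewrite (riemannZl nablaP) Zm scalerA rr -[- y]scaleN1r.
rewrite (riemannDl nablaP) (riemannZl nablaP) !Dm !alt.
rewrite (riemann_antisym nablaP x y) add0r addr0 scalerN scaleN1r opprK.
by apply/rowP => i; rewrite !mxE; field.
Qed.

Lemma metric_rotate (u v : tangent p) (e : R) : e * e = 1 ->
  metric M u u = 1 -> metric M v v = 1 -> metric M u v = 0 ->
  metric M (r *: (u + e *: v)) (r *: (u + e *: v)) = 1.
Proof.
move=> ee uu vv uv; rewrite metricZl metricZr mulrA rr.
rewrite !(metricDl, metricDr) !(metricZl, metricZr) uu vv (metricC v) uv.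
rewrite !mulr0 addr0 add0r mulr1 ee; lra.
Qed.

(** R(Y, Z) maps X to sigma W and W to - sigma X: a multiple of a quarter turn
    of the plane of W and X, which commutes with the rotation. *)
Lemma solves_svp_rotate W X Y Z : metric M W X = 0 ->
  solves_svp nabla W X Y Z sigma ->
  solves_svp nabla (r *: (W - X)) (r *: (W + X)) Y Z sigma.
Proof.
move=> WX [[EW EX EY EZ] [WW XX YY ZZ]].
have EW' : riemann nabla Z Y X = - (sigma *: W).
  by rewrite -EW (riemann_antisym nablaP).
have EX' : riemann nabla Y Z W = - (sigma *: X).
  by rewrite -EX (riemann_antisym nablaP).
do 2 split=> //.
- rewrite (riemannZr nablaP) (riemannDr nablaP) EW EX'.
  by apply/rowP => i; rewrite !mxE; ring.
- rewrite (riemannZr nablaP) -[- X]scaleN1r (riemannDr nablaP) (riemannZr nablaP).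
  rewrite EW' EX scaleN1r opprK.
  by apply/rowP => i; rewrite !mxE; ring.
- by rewrite riemann_rotate.
- rewrite (riemann_antisym nablaP) riemann_rotate -EZ.
  by rewrite (riemann_antisym nablaP W X).
- by rewrite -[- X]scaleN1r metric_rotate// mulrNN mulr1.
- by rewrite -[X]scale1r metric_rotate// mulr1.
Qed.

End SingularValue.

Theorem proposition4 (R : realType) (n : nat) (M : riemannian_manifold R n)
    (nabla : covder M) (nablaP : is_levi_civita nabla)
    (p : M) (W X Y Z : tangent p) (sigma : R) :
  solves_svp nabla W X Y Z sigma ->
  (sigma = 0 -> metric M W X = 0 /\ metric M Y Z = 0) ->
  [/\ solves_svp nabla
        ((Num.sqrt 2)^-1 *: (W - X)) ((Num.sqrt 2)^-1 *: (W + X)) Y Z sigma,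
      solves_svp nabla
        W X ((Num.sqrt 2)^-1 *: (Y - Z)) ((Num.sqrt 2)^-1 *: (Y + Z)) sigma &
      solves_svp nabla
        ((Num.sqrt 2)^-1 *: (W + X)) ((Num.sqrt 2)^-1 *: (W - X))
        ((Num.sqrt 2)^-1 *: (Y + Z)) ((Num.sqrt 2)^-1 *: (Y - Z)) sigma].
Proof.
move=> S S0.
have WX : metric M W X = 0.
  by apply: (solves_svp_orthogonal nablaP S) => /S0[].
have YZ : metric M Y Z = 0.
  by apply: (solves_svp_orthogonal nablaP (solves_svp_exchange S)) => /S0[].
have S2 : solves_svp nabla W X
    ((Num.sqrt 2)^-1 *: (Y - Z)) ((Num.sqrt 2)^-1 *: (Y + Z)) sigma.
  by apply/solves_svp_exchange/(solves_svp_rotate nablaP YZ)/solves_svp_exchange.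
split=> //; first exact: solves_svp_rotate.
(* The third tuple: both pairs are rotated, and the roles in each exchanged. *)
by apply/solves_svp_swap/(solves_svp_rotate nablaP WX).
Qed.
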